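(* Let $K$ be any field and let $J \subset K[x_1,\ldots,x_m]$ be a binomial ideal containing no binomial of the form $\mathbf{x}^{\mathbf{u}}-1$ with $\mathbf{u}\neq \mathbf{0}$. Let $\Delta_J$ be the simplicial complex associated to $J$ and let $\Omega=\{0,1,\ldots,\dim(\Delta_J)\}$. Then $\mathrm{bar}(J)\geq \delta(\Delta_J)_{\{0,1\}}$ and $\mathrm{ara}_c(J)\geq \delta(\Delta_J)_{\Omega}$.
   Context: For $\mathbf{u}=(u_1,\ldots,u_m)\in\mathbb{N}^m$ ($\mathbb{N}$ = non-negative integers) write $\mathbf{x}^{\mathbf{u}}=x_1^{u_1}\cdots x_m^{u_m}$. A binomial is a difference of two monomials $\mathbf{x}^{\mathbf{u}}-\mathbf{x}^{\mathbf{v}}$; a binomial ideal is an ideal generated by binomials. A polynomial $F=c_1M_1+\cdots+c_sM_s\in J$ (with $c_i\in K$ nonzero and $M_1,\ldots,M_s$ distinct monomials) is $J$-complete if $M_i-M_l\in J$ for all $1\le i<l\le s$. The binomial arithmetical rank $\mathrm{bar}(J)$ is the smallest $s$ for which there exist binomials $B_1,\ldots,B_s\in J$ with $\mathrm{rad}(J)=\mathrm{rad}(B_1,\ldots,B_s)$. The $J$-complete arithmetical rank $\mathrm{ara}_c(J)$ is the smallest $s$ for which there exist $J$-complete polynomials $F_1,\ldots,F_s\in J$ with $\mathrm{rad}(J)=\mathrm{rad}(F_1,\ldots,F_s)$. A monomial $M$ is indispensable of $J$ if every generating set of $J$ consisting of binomials contains a binomial $B$ such that $M$ is a monomial of $B$;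 equivalently, $M$ is a minimal generator of the monomial ideal generated by all monomials $M$ for which there is a nonzero binomial $M-N\in J$. The support of a monomial is $\mathrm{supp}(\mathbf{x}^{\mathbf{u}})=\{i : x_i \text{ divides } \mathbf{x}^{\mathbf{u}}\}$. Let $\mathcal{T}$ be the set of all $E\subset\{1,\ldots,m\}$ such that $E=\mathrm{supp}(M)$ for some indispensable monomial $M$ of $J$, and let $\mathcal{T}_{\min}$ be the set of inclusion-minimal elements of $\mathcal{T}$. The simplicial complex $\Delta_J$ has vertex set $\mathcal{T}_{\min}$, and a subset $\{E_1,\ldots,E_k\}\subset\mathcal{T}_{\min}$ is a simplex of $\Delta_J$ if there exist monomials $M_1,\ldots,M_k$ with $\mathrm{supp}(M_i)=E_i$ and $M_i-M_l\in J$ for all $1\le i<l\le k$. Let $\Delta$ be a simplicial complex and $Q$ a set of non-negative integers. A $Q$-matching in $\Delta$ is a set $\mathcal{N}=\{T_1,\ldots,T_s\}$ of simplices of $\Delta$ that are pairwise disjoint ($T_k\cap T_l=\emptyset$ for $k\ne l$) and satisfy $\dim(T_k)\in Q$ for all $k$. Put $\mathrm{supp}(\mathcal{N})=\bigcup_{i=1}^s T_i$ (a set of vertices) and $\mathrm{card}(\mathcal{N})=s$. A $Q$-matching is maximal if $\mathrm{supp}(\mathcal{N})$ has the maximum possible cardinality among all $Q$-matchings in $\Delta$. Then $\delta(\Delta)_Q$ denotes the minimum of $\mathrm{card}(\mathcal{N})$ over all maximal $Q$-matchings $\mathcal{N}$ in $\Delta$. *)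

(* Defs.v *)
From mathcomp Require Import all_boot all_order all_algebra.
From mathcomp Require Import boolp classical_sets.
From mathcomp Require Import mpoly.

Set Implicit Arguments.
Unset Strict Implicit.
Unset Printing Implicit Defensive.

Import GRing.Theory.
Local Open Scope ring_scope.

(* Least element of P; the value 0 is a default used only when P is empty. *)
Definition natmin (P : nat -> Prop) : nat :=
  if pselect (exists n, `[< P n >]) is left exP then ex_minn exP else 0%N.


(* The vertices are those v : V with [set v] a face; V may be larger. *)
Record complex (V : finType) := Complex {
  faces :> {set {set V}};
  faces_sub : forall S T : {set V}, T \subset S -> S \in faces -> T \in faces
}.

(* Dimensions are integers, so that the empty simplex has dimension -1 and is
   never a member of a Q-matching. *)
Definition sdim (V : finType) (T : {set V}) : int := (#|T|)%:Z - 1.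

Definition cdim (V : finType) (D : complex V) : int :=
  (\max_(T in faces D) #|T|)%N%:Z - 1.

Definition is_matching (V : finType) (D : complex V) (Q : set nat)
    (N : {set {set V}}) : Prop :=
  [/\ N \subset faces D, finset.trivIset N
    & forall T, T \in N -> exists2 d : nat, Q d & sdim T = d%:Z].

(* The support of a matching N is [finset.cover N]. *)
Definition maximal_matching (V : finType) (D : complex V) (Q : set nat)
    (N : {set {set V}}) : Prop :=
  is_matching D Q N /\
  forall N', is_matching D Q N' -> (#|finset.cover N'| <= #|finset.cover N|)%N.

Definition delta (V : finType) (D : complex V) (Q : set nat) : nat :=
  natmin (fun s => exists2 N, maximal_matching D Q N & #|N| = s).

Definition Omega (V : finType) (D : complex V) : set nat :=
  fun d => d%:Z <= cdim D.


Section Ideals.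
Variables (K : fieldType) (m : nat).
Implicit Types (J G I : set {mpoly K[m]}) (F B : {mpoly K[m]}).
Implicit Types (M N : 'X_{1..m}).

Definition is_ideal I : Prop :=
  I 0 /\ forall a f g, I f -> I g -> I (a * f + g).

Definition ideal_gen G : set {mpoly K[m]} := smallest is_ideal G.

Definition rad I : set {mpoly K[m]} := fun f => exists n, I (f ^+ n).

(* The zero polynomial x^u - x^u is allowed. *)
Definition is_binomial B : Prop := exists M N, B = 'X_[M] - 'X_[N].

Definition binomial_ideal J : Prop :=
  exists2 G, (forall B, G B -> is_binomial B) & J = ideal_gen G.

Definition J_complete J F : Prop :=
  J F /\ forall M N, M \in msupp F -> N \in msupp F -> J ('X_[M] - 'X_[N]).

Definition bar J : nat :=
  natmin (fun s => exists2 B : 'I_s -> {mpoly K[m]},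
    forall i, J (B i) /\ is_binomial (B i)
    & rad J = rad (ideal_gen (range B))).

Definition ara_c J : nat :=
  natmin (fun s => exists2 F : 'I_s -> {mpoly K[m]},
    forall i, J_complete J (F i)
    & rad J = rad (ideal_gen (range F))).

Definition indispensable J M : Prop :=
  forall G, (forall B, G B -> is_binomial B) -> J = ideal_gen G ->
    exists2 B, G B & M \in msupp B.

Definition supp M : {set 'I_m} := [set i | (0 < M i)%N].

Definition Tsupp J : {set {set 'I_m}} :=
  [set E | `[< exists2 M, indispensable J M & supp M = E >]].

Definition Tmin J : {set {set 'I_m}} :=
  [set E | minset (fun E' => E' \in Tsupp J) E].

Definition is_simplex J (S : {set {set 'I_m}}) : Prop :=
  S \subset Tmin J /\
  exists M : {set 'I_m} -> 'X_{1..m},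
    (forall E, E \in S -> supp (M E) = E) /\
    (forall E E', E \in S -> E' \in S -> J ('X_[M E] - 'X_[M E'])).

Definition simplices J : {set {set {set 'I_m}}} := [set S | `[< is_simplex J S >]].

Lemma simplices_sub J (S T : {set {set 'I_m}}) :
  T \subset S -> S \in simplices J -> T \in simplices J.
Proof.
move=> sTS; rewrite !inE => -[sS [M [Ms MJ]]].
split; first exact: fintype.subset_trans sS.
exists M; split=> [E /(fintype.subsetP sTS)|E E' /(fintype.subsetP sTS) ES].
  exact: Ms.
by move=> /(fintype.subsetP sTS); apply: MJ.
Qed.

Definition Delta J : complex {set 'I_m} := Complex (@simplices_sub J).

End Ideals.

(* Main.v *)
(** A J-complete polynomial contributes to Delta_J the simplex of those
    elements of T_min that are supports of its monomials; the simplex has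
    dimension at most 1 when the polynomial is a binomial.  If rad J is the
    radical of (F_1, ..., F_s) with every F_i J-complete, these s simplices
    cover T_min: given E in T_min, set the variables outside E to zero.  A
    monomial of F_i surviving the substitution lies in a nonzero binomial of J,
    so it is divisible by an indispensable monomial, and minimality of E forces
    its support to be E.  If no F_i had such a monomial, every F_i, hence J,
    would vanish under the substitution, contradicting that some nonzero
    binomial of J has a monomial with support E.  Making the simplices disjoint
    then gives a matching with at most s members that covers all vertices.  The
    numbers bar J and ara_c J are attained because Dickson's lemma provides
    finitely many binomials generating J. *)
Require Import Defs.
From mathcomp Require Import all_boot all_order all_algebra.
From mathcomp Require Import boolp classical_sets.
From mathcomp Require Import mpoly.

Local Open Scope ring_scope.
Import GRing.Theory Order.TTheory.

(** * Least elements, and matchings extracted from covers by faces *)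

Lemma natmin_le (P : nat -> Prop) n : P n -> (natmin P <= n)%N.
Proof.
move=> Pn; rewrite /natmin; case: pselect => [exP|//].
by case: ex_minnP => k _; apply; apply/asboolP.
Qed.

Lemma natminP (P : nat -> Prop) : (exists n, P n) -> P (natmin P).
Proof.
case=> n Pn; rewrite /natmin; case: pselect => [exP|[]].
  by case: ex_minnP => k /asboolP.
by exists n; apply/asboolP.
Qed.

(** Removing from each [S i] the vertices of the earlier faces makes the faces disjoint and keeps
    their union. That union contains every face, so no matching has larger support. Empty
    differences are dropped because their dimension is -1. *)
Lemma delta_le_cover (V : finType) (D : complex V) (Q : set nat) s
    (S : 'I_s -> {set V}) :
  (forall i, S i \in faces D) ->
  (forall i (T : {set V}), T \subset S i -> T != finset.set0 ->
     exists2 d : nat, Q d & sdim T = d%:Z) ->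
  (forall T : {set V}, T \in faces D -> T \subset \bigcup_i S i) ->
  (delta D Q <= s)%N.
Proof.
move=> SD SQ SV.
pose T i := S i :\: \bigcup_(j < s | (j < i)%N) S j.
pose N := [set T i | i : 'I_s] :\ finset.set0.
have TS i : T i \subset S i by apply: subsetDl.
have ND : N \subset faces D.
  apply/fintype.subsetP => _ /setD1P[_ /imsetP[i _ ->]].
  exact: faces_sub (TS i) (SD i).
have coverN : finset.cover N = \bigcup_i S i.
  apply/setP => x; apply/bigcupP/bigcupP.
    by case=> _ /setD1P[_ /imsetP[i _ ->]] /(fintype.subsetP (TS i)); exists i.
  case=> i0 _ xS0.
  (* The least index [i] with [x] in [S i] is the one whose difference [T i] keeps [x]. *)
  case: (arg_minnP (P := fun i => x \in S i) (fun i : 'I_s => i : nat) xS0) => i xS imin.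
  have xT : x \in T i.
    rewrite inE xS andbT; apply/bigcupP => -[j ji xj].
    by move: ji; rewrite ltnNge imin.
  exists (T i) => //; apply/setD1P; split; last exact: imset_f.
  by apply/set0Pn; exists x.
have NM : maximal_matching D Q N.
  split; last first.
    move=> N' [N'D _ _]; rewrite coverN; apply/subset_leq_card/bigcupsP => U UN.
    by apply: SV; apply: (fintype.subsetP N'D).
  split=> //.
    apply/finset.trivIsetP => _ _ /setD1P[_ /imsetP[i _ ->]] /setD1P[_ /imsetP[j _ ->]] nij.
    have {nij} : i != j by apply: contraNneq nij => ->.
    wlog ij : i j / (i < j)%N => [hw|_].
      rewrite neq_ltn => /orP[] ltij.
        by apply: hw => //; rewrite neq_ltn ltij.
      by rewrite disjoint_sym; apply: hw => //; rewrite neq_ltn ltij.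
    rewrite disjoint_subset; apply/fintype.subsetP => x xi.
    rewrite !inE negb_and negbK; apply/orP; left; apply/bigcupP; exists i => //.
    exact: (fintype.subsetP (TS i)).
  by move=> U /setD1P[U0 /imsetP[i _ UE]]; apply: (SQ i); rewrite // UE.
apply: (@leq_trans #|N|); first by apply: natmin_le; exists N.
apply: leq_trans (subset_leq_card (subsetDl _ _)) _.
by apply: leq_trans (leq_imset_card _ _) _; rewrite card_ord.
Qed.

Lemma sdim_nat {V : finType} (T : {set V}) :
  T != finset.set0 -> sdim T = (#|T|.-1)%:Z.
Proof.
by rewrite -card_gt0 /sdim; case: #|T| => // n _; rewrite intS addrC addKr.
Qed.

Lemma sdim_le_cdim (V : finType) (D : complex V) (T : {set V}) :
  T \in faces D -> sdim T <= cdim D.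
Proof.
by move=> TD; rewrite /sdim /cdim Num.Theory.lerD2r lez_nat; apply: leq_bigmax_cond.
Qed.

(** * Dickson's lemma *)

(* Monomials are compared only along the coordinates in [s], so that the
   induction can run over [s]. *)
Lemma dickson_coords m (s : seq 'I_m) (A : 'X_{1..m} -> Prop) :
  exists2 t : seq 'X_{1..m}, (forall b, b \in t -> A b) &
    forall a, A a -> exists2 b, b \in t & forall i, i \in s -> (b i <= a i)%N.
Proof.
elim: s A => [|i s IH] A.
  have [[a Aa]|nA] := pselect (exists a, A a).
    exists [:: a] => [b|b _]; first by rewrite inE => /eqP->.
    by exists a; rewrite // inE.
  by exists [::] => // a Aa; case: nA; exists a.
have [t0 t0A t0P] := IH A.
(* [c] bounds the [i]-th coordinate on [t0], so [t0] serves every [a] with [c <= a i]. Each of the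
   finitely many slices with [a i] fixed below [c] is served by the induction hypothesis. *)
pose c := \max_(b <- t0) (b i : nat).
have [t tA tP] : exists2 t : seq 'X_{1..m}, (forall b, b \in t -> A b) &
    forall a, A a -> (a i < c)%N ->
      exists2 b, b \in t & forall j, j \in i :: s -> (b j <= a j)%N.
  elim: c => [|c [t tA tP]]; first by exists [::].
  have [t' t'A t'P] := IH (fun a => A a /\ a i = c).
  exists (t ++ t') => [b|a Aa].
    by rewrite mem_cat => /orP[/tA|/t'A[]].
  rewrite ltnS leq_eqVlt => /orP[/eqP aic|aic].
    have [b bt' bP] := t'P a (conj Aa aic).
    exists b => [|j]; first by rewrite mem_cat bt' orbT.
    by rewrite inE => /orP[/eqP->|/bP//]; rewrite (t'A b bt').2 aic.
  by have [b bt bP] := tP a Aa aic; exists b; rewrite // mem_cat bt.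
exists (t0 ++ t) => [b|a Aa]; first by rewrite mem_cat => /orP[/t0A|/tA].
have [aic|cai] := ltnP (a i) c.
  by have [b bt bP] := tP a Aa aic; exists b; rewrite // mem_cat bt orbT.
have [b bt bP] := t0P a Aa; exists b => [|j]; first by rewrite mem_cat bt.
rewrite inE => /orP[/eqP->|/bP//]; apply: leq_trans cai.
exact: (leq_bigmax_seq (F := fun b : 'X_{1..m} => b i : nat)).
Qed.

Lemma dickson m (A : 'X_{1..m} -> Prop) :
  exists2 t : seq 'X_{1..m}, (forall b, b \in t -> A b) &
    forall a, A a -> exists2 b, b \in t & (b <= a)%MM.
Proof.
have [t tA tP] := dickson_coords _ (enum 'I_m) A; exists t => // a /tP[b bt ba].
by exists b => //; apply/mnm_lepP => i; apply: ba; rewrite mem_enum.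
Qed.

(** * Ideals and binomials in the polynomial ring *)

Section Ideals.
Variables (K : fieldType) (m : nat).
Implicit Types (I J G : set {mpoly K[m]}) (M N : 'X_{1..m}).

Lemma idealM I a f : is_ideal I -> I f -> I (a * f).
Proof. by case=> I0 IP If; rewrite -[_ * _]addr0; apply: IP. Qed.

Lemma idealD I f g : is_ideal I -> I f -> I g -> I (f + g).
Proof. by case=> I0 IP If Ig; rewrite -[f]mul1r; apply: IP. Qed.

Lemma idealN I f : is_ideal I -> I f -> I (- f).
Proof. by move=> Iid If; rewrite -mulN1r; apply: idealM. Qed.

Lemma idealB I f g : is_ideal I -> I f -> I g -> I (f - g).
Proof. by move=> Iid If Ig; apply: idealD => //; apply: idealN. Qed.

Lemma ideal_gen_ideal G : is_ideal (ideal_gen G).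
Proof.
split=> [I [[]]//|a f g fG gG I [Iid GI]].
by apply: Iid.2; [apply: fG | apply: gG].
Qed.

Lemma ideal_gen_sub G : (G `<=` ideal_gen G)%classic.
Proof. by move=> f Gf I [_ GI]; apply: GI. Qed.

Lemma ideal_gen_min G I :
  is_ideal I -> (G `<=` I)%classic -> (ideal_gen G `<=` I)%classic.
Proof. by move=> Iid GI f; apply. Qed.

Lemma ker_ideal (R : comNzRingType) (h : {rmorphism {mpoly K[m]} -> R}) :
  is_ideal (fun f : {mpoly K[m]} => h f = 0).
Proof.
by split=> [|a f g hf hg]; rewrite ?rmorph0 // rmorphD rmorphM hf hg mulr0 addr0.
Qed.

(** A coefficient of [a * f] at [M] involves only coefficients of [f] at divisors of [M]. With [D]
    the divisors of a fixed monomial, this serves to show that the monomial is indispensable. *)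
Lemma lower_set_ideal (D : 'X_{1..m} -> Prop) :
  (forall M N, (M <= N)%MM -> D N -> D M) ->
  is_ideal (fun f : {mpoly K[m]} => forall M, D M -> f@_M = 0).
Proof.
move=> Ddown; split=> [M _|a f g f0 g0 M DM]; first exact: mcoeff0.
rewrite mcoeffD g0 // addr0 mcoeffM big1 // => k /eqP Mk.
have kM : (k.2 <= M)%MM by rewrite [X in (_ <= X)%MM]Mk lem_addl.
by rewrite f0 ?mulr0 //; apply: Ddown DM.
Qed.

Lemma msupp_binomial M N L :
  L \in msupp ('X_[M] - 'X_[N] : {mpoly K[m]}) -> (L = M \/ L = N) /\ M <> N.
Proof.
rewrite mcoeff_msupp mcoeffB !mcoeffX => nz; split; last first.
  by move=> MN; move: nz; rewrite MN subrr eqxx.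
move: nz; case: (eqVneq M L) => [->|_]; first by left.
by case: (eqVneq N L) => [->|_]; [right | rewrite subrr eqxx].
Qed.

(** * Finite generation and indispensable monomials of a binomial ideal *)

Section BinomialIdeal.
Variable J : set {mpoly K[m]}.
Hypothesis J_binomial : binomial_ideal J.

Let J_ideal : is_ideal J.
Proof. by case: J_binomial => G _ ->; apply: ideal_gen_ideal. Qed.

Lemma binomial_swap M N : J ('X_[M] - 'X_[N]) -> J ('X_[N] - 'X_[M]).
Proof. by move=> JMN; rewrite -opprB; apply: idealN. Qed.

(** Division along the monomial order: a binomial of [J] with larger term [M] is reduced by a chosen
    binomial whose leading monomial divides [M], and well-founded induction on [M] concludes. *)
Lemma finite_binomial_gen :
  exists2 t : seq {mpoly K[m]}, (forall B, B \in t -> J B /\ is_binomial B) &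
    J = ideal_gen [set` t].
Proof.
(* [A] collects the monomials that a binomial of [J] trades for a smaller one; [t] contains a
   divisor of each. *)
pose A M := exists N, (N < M)%O /\ J ('X_[M] - 'X_[N]).
have [t tA tP] := dickson m A.
have [nu nuP] : exists nu : 'X_{1..m} -> 'X_{1..m},
    forall M, A M -> (nu M < M)%O /\ J ('X_[M] - 'X_[nu M]).
  have /choice[nu nuP] : forall M, exists N,
      A M -> (N < M)%O /\ J ('X_[M] - 'X_[N]).
    by move=> M; have [[N AN]|nA] := pselect (A M); [exists N | exists M].
  by exists nu.
pose bt := [seq 'X_[M] - 'X_[nu M] : {mpoly K[m]} | M <- t].
have btP B : B \in bt -> J B /\ is_binomial B.
  by move=> /mapP[M /tA/nuP[_ JM] ->]; split=> //; exists M, (nu M).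
have gen_id := ideal_gen_ideal [set` bt].
have le_gen M : forall N, (N <= M)%O -> J ('X_[M] - 'X_[N]) ->
    ideal_gen [set` bt] ('X_[M] - 'X_[N]).
  elim/(ltmwf (n := m)): M => M IH N; rewrite le_eqVlt => /orP[/eqP->|NM] JMN.
    by rewrite subrr; apply: gen_id.1.
  have [b b_t bM] := tP M (ex_intro _ N (conj NM JMN)).
  have [nub Jb] := nuP b (tA b b_t).
  have Bgen : ideal_gen [set` bt] ('X_[b] - 'X_[nu b]).
    by apply: ideal_gen_sub; apply: (map_f (fun M => 'X_[M] - 'X_[nu M])).
  (* [P] is [M] after one reduction step, replacing its factor [b] by [nu b]. *)
  pose P := (M - b + nu b)%MM.
  have PM : (P < M)%O by rewrite -[X in (_ < X)%O](submK bM) ltmc_add2r.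
  have XM : 'X_[M] - 'X_[P] = 'X_[M - b] * ('X_[b] - 'X_[nu b]) :> {mpoly K[m]}.
    by rewrite mulrBr -!mpolyXD submK.
  have JPN : J ('X_[P] - 'X_[N]).
    have -> : 'X_[P] - 'X_[N] = ('X_[M] - 'X_[N]) - ('X_[M] - 'X_[P])
        :> {mpoly K[m]}.
      by rewrite opprB [RHS]addrC addrA subrK.
    by apply: (idealB J) => //; rewrite XM; apply: (idealM J).
  rewrite -[_ - _](subrKA 'X_[P]) XM; apply: (idealD (ideal_gen [set` bt])) => //.
    exact: (idealM (ideal_gen [set` bt])).
  (* Both [P] and [N] lie below [M], so induction applies at the larger of the two. *)
  have [NP|/ltW PN] := leP N P; first exact: IH.
  by rewrite -opprB; apply: (idealN (ideal_gen [set` bt])) => //; apply: IH => //; apply: binomial_swap.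
exists bt => //; apply/seteqP; split; last first.
  by apply: ideal_gen_min => // B /btP[].
case: J_binomial => G Gbin JG f; rewrite {1}JG; move: f.
apply: ideal_gen_min => // B GB; have JB : J B by rewrite JG; apply: ideal_gen_sub.
have [M [N BE]] := Gbin B GB; rewrite BE in JB *.
have [NM|/ltW MN] := leP N M; first exact: le_gen.
by rewrite -opprB; apply: (idealN (ideal_gen [set` bt])) => //; apply: le_gen => //; apply: binomial_swap.
Qed.

(** Every binomial vanishes at the point with all coordinates 1. Hence [J] contains no nonzero
    multiple of a single monomial. *)
Lemma meval1_binomial_ideal f : J f -> f.@[fun => 1] = 0.
Proof.
case: J_binomial => G Gbin ->.
apply: (ideal_gen_min _ (fun f => f.@[fun => 1] = 0)).
  exact: (ker_ideal _ (meval (fun => 1))).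
move=> B /Gbin[M [N ->]]; rewrite /= mevalB !mevalX.
by rewrite !big1 ?subrr // => i _; rewrite expr1n.
Qed.

Lemma msupp_other f M :
  J f -> M \in msupp f -> exists2 N, N \in msupp f & N != M.
Proof.
move=> Jf Mf; have [/hasP[N Nf NM]|/hasPn nN] := boolP (has (predC1 M) (msupp f)).
  by exists N.
have f_mono : f = f@_M *: 'X_[M].
  apply/mpolyP => L; rewrite mcoeffZ mcoeffX.
  have [<-|ML] := eqVneq M L; first by rewrite mulr1.
  rewrite mulr0; apply/eqP; rewrite mcoeff_eq0; apply/negP => /nN /=.
  by rewrite eq_sym ML.
have := meval1_binomial_ideal f Jf; rewrite f_mono mevalZ mevalX.
rewrite big1 => [|i _]; last by rewrite expr1n.
by rewrite mulr1 => fM0; move: Mf; rewrite mcoeff_msupp fM0 eqxx.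
Qed.

Lemma indispensable_binomial M :
  indispensable J M -> exists2 N, M <> N & J ('X_[M] - 'X_[N]).
Proof.
case: J_binomial => G Gbin JG /(_ G Gbin JG)[B GB].
have JB : J B by rewrite JG; apply: ideal_gen_sub.
have [P [N BE]] := Gbin B GB; rewrite BE in JB * => /msupp_binomial[[]-> PN].
  by exists N.
by exists P; [apply/nesym | apply: binomial_swap].
Qed.

(** Descend to an [M] none of whose proper divisors occurs in a nonzero binomial of [J]. If binomial
    generators avoided [M], their coefficients would vanish at all divisors of [M]; so would those
    of every element of [J], although [M] has coefficient 1 in the given binomial. *)
Lemma binomial_indispensable M N : M <> N -> J ('X_[M] - 'X_[N]) ->
  exists2 L, indispensable J L & (L <= M)%MM.
Proof.
elim/(ltmwf (n := m)): M N => M IH N MN JMN.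
have [[L [P [LM neLM LP JLP]]]|minM] := pselect (exists L P,
    [/\ (L <= M)%MM, L <> M, L <> P & J ('X_[L] - 'X_[P])]).
  have ltLM : (L < M)%O by rewrite lt_neqAle lem_leo // andbT; apply/eqP.
  have [L' indL' L'L] := IH L ltLM P LP JLP.
  by exists L' => //; apply: lepm_trans LM.
exists M; last exact: lepm_refl.
move=> G Gbin JG; apply: contrapT => nG.
have zero_below : (G `<=` fun f => forall L, (L <= M)%MM -> f@_L = 0)%classic.
  move=> B GB L LM; apply/eqP; apply: contrapT => /negP.
  rewrite -mcoeff_msupp => LB.
  have LneM : L <> M by move=> LEM; apply: nG; exists B; rewrite // -LEM.
  have JB : J B by rewrite JG; apply: ideal_gen_sub.
  have [P [Q BE]] := Gbin B GB; rewrite BE in JB LB.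
  have [[LE|LE] PQ] := msupp_binomial P Q L LB; apply: minM; subst L.
    by exists P, Q.
  by exists Q, P; split=> //; [apply/nesym | apply: binomial_swap].
have down L L' : (L <= L')%MM -> (L' <= M)%MM -> (L <= M)%MM.
  by move=> LL' L'M; apply: lepm_trans L'M.
move: JMN; rewrite JG => JMN.
have /(_ M (lepm_refl M)) :=
  ideal_gen_min G _ (lower_set_ideal _ down) zero_below _ JMN.
rewrite mcoeffB !mcoeffX eqxx; case: eqVneq => [NM|_]; first by case: MN.
by move/eqP; rewrite subr0 oner_eq0.
Qed.

Lemma supp_le M N : (M <= N)%MM -> supp M \subset supp N.
Proof.
move=> /mnm_lepP MN; apply/fintype.subsetP => i; rewrite !inE => Mi.
exact: leq_trans Mi (MN i).
Qed.

Definition restr (E : {set 'I_m}) : m.-tuple {mpoly K[m]} :=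
  [tuple if i \in E then 'X_i else 0 | i < m].

Lemma restrX E M :
  'X_[M] \mPo restr E = if supp M \subset E then 'X_[M] else 0.
Proof.
rewrite comp_mpolyX; case: ifPn => [/fintype.subsetP ME|/subsetPn[i iM iE]].
  rewrite [RHS]mpolyXE_id; apply: eq_bigr => i _; rewrite tnth_mktuple.
  case: ifPn => // iE; suff -> : M i = 0%N by rewrite !expr0.
  by apply/eqP; rewrite -leqn0 leqNgt; apply: contra iE => Mi; apply: ME; rewrite inE.
rewrite (bigD1 i) //= tnth_mktuple (negPf iE) expr0n.
by move: iM; rewrite inE lt0n => /negPf->; rewrite mul0r.
Qed.

(** * Covering the minimal supports by simplices *)

Section Cover.
Variables (s : nat) (F : 'I_s -> {mpoly K[m]}).
Hypothesis F_complete : forall i, J_complete J (F i).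
Hypothesis F_rad : Defs.rad J = Defs.rad (ideal_gen (range F)).

Lemma Tmin_msupp E : E \in Tmin J ->
  exists i, exists2 M, M \in msupp (F i) & supp M = E.
Proof.
rewrite inE => /minsetP[+ Emin]; rewrite inE => /asboolP[M indM ME].
have [N MN JMN] := indispensable_binomial M indM.
apply: contrapT => nE; pose phi := comp_mpoly (restr E).
have phiF : (range F `<=` fun f => phi f = 0)%classic.
  move=> _ [i _ <-]; have [JF FJ] := F_complete i.
  rewrite /phi [F i]mpolyE raddf_sum /= big_seq big1 // => P PF.
  rewrite linearZ /= restrX; case: ifPn => [PE|_]; last by rewrite scaler0.
  have [P' P'F P'P] := msupp_other _ P JF PF.
  have [L indL LP] := binomial_indispensable P P' (nesym (elimN eqP P'P)) (FJ _ _ PF P'F).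
  case: nE; exists i, P => //; apply/eqP; rewrite finset.eqEsubset PE /=.
  have LT : supp L \in Tsupp J by rewrite inE; apply/asboolP; exists L.
  by rewrite -(Emin _ LT (fintype.subset_trans (supp_le _ _ LP) PE)) supp_le.
have phi_ker : is_ideal (fun f => phi f = 0) by apply: ker_ideal.
have : Defs.rad J ('X_[M] - 'X_[N]) by exists 1%N; rewrite expr1.
rewrite F_rad => -[n /(ideal_gen_min _ _ phi_ker phiF) phi0].
(* The polynomial ring is a domain, so the power can be removed. *)
have {phi0} : phi ('X_[M] - 'X_[N]) = 0.
  by apply/eqP; move/eqP: phi0; rewrite /phi rmorphXn expf_eq0 => /andP[].
rewrite /phi raddfB /= !restrX ME subxx => /(congr1 (mcoeff M)).
(* The first term survives with coefficient 1 at [M]; the second contributes 0 there, whether it is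
   killed or not, since [N] differs from [M]. *)
rewrite mcoeffB mcoeff0 mcoeffX eqxx; case: ifP => _.
  by rewrite mcoeffX eq_sym; case: eqP => // _ /eqP; rewrite subr0 oner_eq0.
by move/eqP; rewrite mcoeff0 subr0 oner_eq0.
Qed.

Let S i := [set E in Tmin J | has (fun M => supp M == E) (msupp (F i))].

(** Common core of both bounds: only the condition on dimensions is left open, [#|T|.-1] being the
    dimension of a nonempty [T]. *)
Lemma delta_le (Q : set nat) :
  (forall i (T : {set {set 'I_m}}), T \subset S i -> T \in faces (Delta J) -> T != finset.set0 ->
     Q #|T|.-1) ->
  (delta (Delta J) Q <= s)%N.
Proof.
move=> SQ.
have S_face i : S i \in faces (Delta J).
  rewrite inE; apply/asboolP; split.
    by apply/fintype.subsetP => E; rewrite inE => /andP[].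
  (* Each vertex [E] of [S i] is represented by the first monomial of [F i] with support [E]; the
     default 0 is not reached on [S i]. *)
  exists (fun E => nth 0%MM (msupp (F i)) (find (fun M => supp M == E) (msupp (F i)))).
  have SP E : E \in S i -> has (fun M => supp M == E) (msupp (F i)).
    by rewrite inE => /andP[].
  split=> [E /SP/(nth_find 0%MM)/eqP//|E E' /SP hE /SP hE'].
  by apply: (F_complete i).2; apply: mem_nth; rewrite -has_find.
apply: (@delta_le_cover _ _ _ _ S) => // [i T TS T0|T].
  exists #|T|.-1; last exact: sdim_nat.
  by apply: (SQ i) => //; apply: faces_sub TS (S_face i).
rewrite inE => /asboolP[TJ _]; apply: (fintype.subset_trans TJ).
apply/fintype.subsetP => E ET; have [i [M MF ME]] := Tmin_msupp E ET.
by apply/bigcupP; exists i => //; rewrite inE ET; apply/hasP; exists M => //; apply/eqP.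
Qed.

Lemma delta_Omega_le : (delta (Delta J) (Omega (Delta J)) <= s)%N.
Proof.
by apply: delta_le => i T _ TD T0; rewrite /Omega -sdim_nat //; apply: sdim_le_cdim.
Qed.

Lemma delta01_le : (forall i, is_binomial (F i)) ->
  (delta (Delta J) [set 0%N; 1%N]%classic <= s)%N.
Proof.
move=> Fbin; apply: delta_le => i T TS _ T0; have [M [N FE]] := Fbin i.
(* A binomial has at most two monomials, hence at most two supports. *)
have : (#|T| <= 2)%N.
  apply: (@leq_trans #|[set supp M; supp N]|); last by rewrite cards2; case: eqP.
  apply/subset_leq_card/(fintype.subset_trans TS)/fintype.subsetP => E.
  rewrite !inE => /andP[_ /hasP[L]]; rewrite FE => /msupp_binomial[[]-> _] /eqP->.
    by rewrite eqxx.
  by rewrite eqxx orbT.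
move: T0; rewrite -card_gt0; case: #|T| => [|[|[]]] // _ _; [by left | by right].
Qed.

End Cover.

(** * Attainment of both ranks, and the two bounds *)

(** Makes every family admissible for [bar] admissible for [ara_c] as well. *)
Lemma binomial_complete B : J B -> is_binomial B -> J_complete J B.
Proof.
move=> JB [M [N BE]]; split=> // P Q; rewrite BE in JB *.
move=> /msupp_binomial[PE _] /msupp_binomial[QE _].
case: PE QE => -> [] -> //; rewrite ?subrr; try exact: J_ideal.1.
exact: binomial_swap.
Qed.

(** Since [natmin] is 0 on an empty predicate, a lower bound requires some admissible family; a
    finite binomial generating set is one. *)
Lemma bar_attained : exists s, exists2 B : 'I_s -> {mpoly K[m]},
  forall i, J (B i) /\ is_binomial (B i) & Defs.rad J = Defs.rad (ideal_gen (range B)).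
Proof.
have [t tP JE] := finite_binomial_gen.
exists (size t), (fun i : 'I_(size t) => nth 0 t i).
  by move=> i; apply/tP/mem_nth.
rewrite [in LHS]JE; congr (Defs.rad (ideal_gen _)); apply/seteqP; split.
  by move=> B /= Bt; exists (Ordinal (etrans (index_mem B t) Bt)); rewrite //= nth_index.
by move=> _ [i _ <-]; apply: mem_nth.
Qed.

End BinomialIdeal.
End Ideals.

Theorem theorem2p6 (K : fieldType) (m : nat) (J : set {mpoly K[m]})
    (J_binomial : binomial_ideal J)
    (J_no_unit : forall u : 'X_{1..m}, u <> 0%MM -> ~ J ('X_[u] - 1)) :
  (delta (Delta J) [set 0%N; 1%N]%classic <= bar J)%N /\
  (delta (Delta J) (Omega (Delta J)) <= ara_c J)%N.
Proof.
split.
  have [B BJ Brad] := natminP _ (bar_attained _ _ _ J_binomial).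
  apply: (delta01_le _ _ _ J_binomial _ B _ Brad) => i; last by case: (BJ i).
  by apply: binomial_complete => //; case: (BJ i).
have [|F FJ Frad] := natminP (fun s => exists2 F : 'I_s -> {mpoly K[m]},
    forall i, J_complete J (F i) & Defs.rad J = Defs.rad (ideal_gen (range F))).
  have [s [B BJ Brad]] := bar_attained _ _ _ J_binomial.
  by exists s, B => // i; have [] := BJ i; apply: binomial_complete.
exact: (delta_Omega_le _ _ _ J_binomial _ F FJ Frad).
Qed.
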